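(* Partition the coordinates of $x\in\mathbb{R}^n$ into $m$ non-overlapping groups, $x^\top=[x_1^\top,\dots,x_m^\top]$, and correspondingly $A=[A_1\ A_2\cdots A_m]\in\mathbb{R}^{d\times n}$. Let $\rho_1,\dots,\rho_m>0$ and let $f:\mathbb{R}^d\to\mathbb{R}$ be convex and $L$-smooth. Let $x^\star$ be an optimal solution of $$\min_{x\in\mathbb{R}^n}\ f(Ax)+\sum_{g=1}^m\sqrt{\rho_g}\,\|x_g\|_2 .$$ Then for every $x\in\mathbb{R}^n$ and every group $g$, $$\|A_g^\top\nabla f(Ax)\|_2+\sqrt{2L\,G(x)}\,\|A_g\|_{\mathrm{Fro}}<\sqrt{\rho_g}\ \Longrightarrow\ x_g^\star=0 ,$$ where $G(x)$ is the duality gap.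
   Context: $\|\cdot\|_{\mathrm{Fro}}$ is the Frobenius norm. $L$-smooth means differentiable with $L$-Lipschitz gradient in the Euclidean norm. The duality gap at $x$ of a problem $\min_x f(Ax)+h(x)$, with $f$ differentiable and $h$ closed convex, is $G(x)=f(Ax)+h(x)+f^*(w(x))+h^*(-A^\top w(x))\in[0,+\infty]$ with $w(x)=\nabla f(Ax)$, where $\phi^*(v)=\sup_u v^\top u-\phi(u)$ is the convex conjugate. Here $h(x)=\sum_g\sqrt{\rho_g}\|x_g\|_2$. The hypothesis of the implication is considered not to hold when $G(x)=+\infty$. *)

(* Defs.v *)
From HB Require Import structures.
From mathcomp Require Import all_boot all_order all_algebra.
From mathcomp Require Import all_classical all_reals all_analysis.

Set Implicit Arguments.
Unset Strict Implicit.
Unset Printing Implicit Defensive.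

Import Order.TTheory GRing.Theory Num.Theory.
Import numFieldNormedType.Exports.

Local Open Scope classical_set_scope.
Local Open Scope ring_scope.

(* The library norm `|_| on matrices is the max norm, so the Euclidean and
   Frobenius norms are defined here. *)
Definition norm2 (R : realType) (n : nat) (v : 'cV[R]_n) : R :=
  Num.sqrt (\sum_(i < n) v i 0 ^+ 2).

Definition normFro (R : realType) (m n : nat) (M : 'M[R]_(m, n)) : R :=
  Num.sqrt (\sum_(i < m) \sum_(j < n) M i j ^+ 2).

(* Meaningful at the points where f is differentiable. *)
Definition gradient (R : realType) (d : nat) (f : 'cV[R]_d -> R)
    (y : 'cV[R]_d) : 'cV[R]_d :=
  \col_(i < d) 'd f y (delta_mx i 0).

(* No sign is imposed on L; for d > 0 the inequality forces 0 <= L. *)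
Definition L_smooth (R : realType) (d : nat) (L : R) (f : 'cV[R]_d -> R) :
    Prop :=
  (forall y : 'cV[R]_d, differentiable f y) /\
  (forall y z : 'cV[R]_d,
     norm2 (gradient f y - gradient f z) <= L * norm2 (y - z)).

Definition conjugate (R : realType) (n : nat) (phi : 'cV[R]_n -> R)
    (v : 'cV[R]_n) : \bar R :=
  ereal_sup [set ((v^T *m u) 0 0 - phi u)%:E | u in [set: 'cV[R]_n]].

(* The conjugates of real-valued functions are never -oo, so the sum never
   involves +oo - oo. *)
Definition duality_gap (R : realType) (d n : nat) (f : 'cV[R]_d -> R)
    (h : 'cV[R]_n -> R) (A : 'M[R]_(d, n)) (x : 'cV[R]_n) : \bar R :=
  let w := gradient f (A *m x) in
  ((f (A *m x))%:E + (h x)%:E + conjugate f w + conjugate h (- (A^T *m w)))%E.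

(* Group g consists of p g consecutive coordinates; the g-th subvector of x is
   [submxcol x g] and the g-th column block of A is [submxrow A g]. *)
Definition group_penalty (R : realType) (m : nat) (p : 'I_m -> nat)
    (rho : 'I_m -> R) (x : 'cV[R]_(\sum_(g < m) p g)) : R :=
  \sum_(g < m) Num.sqrt (rho g) * norm2 (submxcol x g).

(* Main.v *)
(** Write w = grad f (A x) and w' = grad f (A xstar).  The descent lemma, used at
    A xstar + (w - w') / L, gives
      f^*(w) >= <w, A xstar> - f (A xstar) + |w - w'|^2 / (2 L);
    with the Fenchel-Young inequality for h at xstar and the optimality of xstar
    this yields |w - w'|^2 <= 2 L G(x).  So the left-hand side of the screening
    test bounds |A_g^T w'|.  If xstar_g <> 0, shrinking that group slightly
    cannot decrease the objective, which forces sqrt rho_g <= |A_g^T w'|. *)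
Require Import Defs.
From HB Require Import structures.
From mathcomp Require Import all_boot all_order all_algebra.
From mathcomp Require Import all_classical all_reals all_analysis.
From mathcomp Require Import ring lra.
Import Order.TTheory GRing.Theory Num.Theory.
Import numFieldNormedType.Exports.
Local Open Scope classical_set_scope.
Local Open Scope ring_scope.

(** * Euclidean inner product, Cauchy-Schwarz and the Frobenius bound *)

Section Euclidean.
Context {R : realType}.

Definition dotv {n} (u v : 'cV[R]_n) : R := (u^T *m v) 0 0.

Lemma dotvE {n} (u v : 'cV[R]_n) : dotv u v = \sum_i u i 0 * v i 0.
Proof. by rewrite /dotv mxE; apply: eq_bigr => i _; rewrite mxE. Qed.

Lemma dotvC {n} (u v : 'cV[R]_n) : dotv u v = dotv v u.
Proof. by rewrite !dotvE; apply: eq_bigr => i _; rewrite mulrC. Qed.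

Lemma dotvDr {n} (u v w : 'cV[R]_n) : dotv u (v + w) = dotv u v + dotv u w.
Proof. by rewrite /dotv mulmxDr mxE. Qed.

Lemma dotvZr {n} (u v : 'cV[R]_n) a : dotv u (a *: v) = a * dotv u v.
Proof. by rewrite /dotv -scalemxAr mxE. Qed.

Lemma dotvNr {n} (u v : 'cV[R]_n) : dotv u (- v) = - dotv u v.
Proof. by rewrite -scaleN1r dotvZr mulN1r. Qed.

Lemma dotvBr {n} (u v w : 'cV[R]_n) : dotv u (v - w) = dotv u v - dotv u w.
Proof. by rewrite dotvDr dotvNr. Qed.

Lemma dotvBl {n} (u v w : 'cV[R]_n) : dotv (u - v) w = dotv u w - dotv v w.
Proof. by rewrite dotvC dotvBr !(dotvC w). Qed.

Lemma dotvNl {n} (u v : 'cV[R]_n) : dotv (- u) v = - dotv u v.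
Proof. by rewrite dotvC dotvNr dotvC. Qed.

Lemma dotvZl {n} (u v : 'cV[R]_n) a : dotv (a *: u) v = a * dotv u v.
Proof. by rewrite dotvC dotvZr dotvC. Qed.

Lemma dotv_tr_mul {m n} (M : 'M[R]_(m, n)) (u : 'cV[R]_m) (v : 'cV[R]_n) :
  dotv (M^T *m u) v = dotv u (M *m v).
Proof. by rewrite /dotv trmx_mul trmxK mulmxA. Qed.

Lemma norm2_ge0 {n} (v : 'cV[R]_n) : 0 <= norm2 v.
Proof. exact: sqrtr_ge0. Qed.

Lemma norm2_sqr {n} (v : 'cV[R]_n) : norm2 v ^+ 2 = dotv v v.
Proof.
rewrite sqr_sqrtr ?dotvE; last by apply: sumr_ge0 => i _; rewrite sqr_ge0.
by apply: eq_bigr => i _; rewrite expr2.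
Qed.

Lemma dotv_ge0 {n} (v : 'cV[R]_n) : 0 <= dotv v v.
Proof. by rewrite -norm2_sqr sqr_ge0. Qed.

Lemma norm2_eq0 {n} {v : 'cV[R]_n} : norm2 v = 0 -> v = 0.
Proof.
move=> v0; have : dotv v v = 0 by rewrite -norm2_sqr v0 expr0n.
rewrite dotvE => /eqP; rewrite psumr_eq0 => [|i _]; last first.
  by rewrite -expr2 sqr_ge0.
move=> /allP vE; apply/colP => i; rewrite mxE.
by have := vE i (mem_index_enum _); rewrite /= mulf_eq0 orbb => /eqP.
Qed.

Lemma norm2Z {n} (v : 'cV[R]_n) a : norm2 (a *: v) = `|a| * norm2 v.
Proof.
apply/eqP; rewrite -(@eqrXn2 _ 2) ?mulr_ge0 ?norm2_ge0 //.
by rewrite exprMn !norm2_sqr dotvZl dotvZr mulrA -expr2 real_normK ?num_real.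
Qed.

Lemma norm2B {n} (u v : 'cV[R]_n) : norm2 (u - v) = norm2 (v - u).
Proof. by rewrite -opprB -scaleN1r norm2Z normrN1 mul1r. Qed.

(** Cauchy-Schwarz: the squared norm of |v|^2 u - <u,v> v is nonnegative and equals |v|^2 (|u|^2
    |v|^2 - <u,v>^2). *)
Lemma dotv_le_norm2 {n} (u v : 'cV[R]_n) : dotv u v <= norm2 u * norm2 v.
Proof.
have [v0|v_neq0] := eqVneq (norm2 v) 0.
  by rewrite (norm2_eq0 v0) /dotv mulmx0 mxE mulr_ge0 ?norm2_ge0.
have v_gt0 : 0 < norm2 v by rewrite lt_def v_neq0 norm2_ge0.
apply: le_trans (ler_norm _) _.
rewrite -(@ler_pXn2r _ 2) ?nnegrE ?mulr_ge0 ?norm2_ge0 //.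
rewrite real_normK ?num_real // -subr_ge0.
rewrite -(pmulr_rge0 _ (exprn_gt0 2 v_gt0)).
have := dotv_ge0 (norm2 v ^+ 2 *: u - dotv u v *: v).
rewrite dotvBl !dotvBr !dotvZl !dotvZr -!norm2_sqr (dotvC v u).
by congr (_ <= _); ring.
Qed.

Lemma norm2D {n} (u v : 'cV[R]_n) : norm2 (u + v) <= norm2 u + norm2 v.
Proof.
rewrite -(@ler_pXn2r _ 2) ?nnegrE ?addr_ge0 ?norm2_ge0 // sqrrD.
rewrite !norm2_sqr dotvDr !(dotvC (u + v)) !dotvDr (dotvC v u).
by have := dotv_le_norm2 u v; lra.
Qed.

(** Each entry of [M^T *m v] is the inner product of a column of [M] with [v]; Cauchy-Schwarz is
    applied columnwise and the squares are summed. *)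
Lemma norm2_tr_mul_le {m n} (M : 'M[R]_(m, n)) (v : 'cV[R]_m) :
  norm2 (M^T *m v) <= normFro M * norm2 v.
Proof.
rewrite /normFro exchange_big /=.
set F := \sum_j _.
have F_ge0 : 0 <= F.
  by apply: sumr_ge0 => j _; apply: sumr_ge0 => i _; rewrite sqr_ge0.
rewrite -(@ler_pXn2r _ 2) ?nnegrE ?mulr_ge0 ?norm2_ge0 ?sqrtr_ge0 //.
rewrite exprMn norm2_sqr dotvE sqr_sqrtr // mulr_suml.
apply: ler_sum => j _.
have -> : (M^T *m v) j 0 = dotv (col j M) v.
  by rewrite dotvE mxE; apply: eq_bigr => i _; rewrite !mxE.
have -> : \sum_i M i j ^+ 2 = norm2 (col j M) ^+ 2.
  by rewrite norm2_sqr dotvE; apply: eq_bigr => i _; rewrite !mxE expr2.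
rewrite -exprMn -expr2 -(real_normK (num_real (dotv _ _))).
rewrite ler_pXn2r ?nnegrE ?mulr_ge0 ?norm2_ge0 // ler_norml dotv_le_norm2 andbT.
rewrite lerNl -dotvNr (le_trans (dotv_le_norm2 _ _)) //.
by rewrite -[- v]scaleN1r norm2Z normrN1 mul1r.
Qed.

End Euclidean.

(** * Smooth functions along a line and the descent lemma *)

Section Smooth.
Context {R : realType} {d : nat} (L : R) (f : 'cV[R]_d -> R).
Hypothesis f_smooth : L_smooth L f.

Let f_diff y : differentiable f y := f_smooth.1 y.

Lemma diff_gradient y v : 'd f y v = dotv (gradient f y) v.
Proof.
rewrite dotvE [v in LHS]matrix_sum_delta linear_sum.
by apply: eq_bigr => i _; rewrite big_ord1 linearZ mxE /= mulrC.
Qed.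

Lemma is_derive_line y v t :
  is_derive t (1 : R) (fun s : R => f (y + s *: v) : R)
    (dotv (gradient f (y + t *: v)) v).
Proof.
have -> : dotv (gradient f (y + t *: v)) v = 'D_v f (y + t *: v).
  by rewrite deriveE // diff_gradient.
(* The difference quotient of the one-variable function is that of [f] in direction [v], so
   derivability and derivative both transfer. *)
have E : (fun h : R => h^-1 *: (f (y + (h *: (1 : R) + t) *: v) - f (y + t *: v)))
   = (fun h : R => h^-1 *: (f (h *: v + (y + t *: v)) - f (y + t *: v))).
  by apply/funext => h; rewrite [h *: _]mulr1 scalerDl addrCA.
split; last by rewrite /derive /= E.
by rewrite /derivable /= E; exact: diff_derivable.
Qed.

Lemma descent_lemma y v :
  f (y + v) <= f y + dotv (gradient f y) v + L / 2 * norm2 v ^+ 2.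
Proof.
pose b := dotv (gradient f y) v; pose q := L / 2 * norm2 v ^+ 2.
(* The claim is [k 1 <= k 0]; by the mean value theorem it suffices that [dk] is nonpositive at an
   intermediate point. *)
pose k s : R := f (y + s *: v) - (b * s + q * s ^+ 2).
pose dk s : R := dotv (gradient f (y + s *: v)) v - (b + q * (2 * s)).
have k_derive s : is_derive s (1 : R) k (dk s).
  rewrite /k /dk; apply: is_deriveB; first exact: is_derive_line.
  apply: is_derive_eq.
  by rewrite /GRing.scale /=; ring.
have k_cont : {within `[0, 1], continuous k}.
  apply: derivable_within_continuous => s _; exact: ex_derive.
have [c] := MVT ltr01 (fun s _ => k_derive s) k_cont.
rewrite in_itv /= => /andP[c_gt0 _].
rewrite /k scale1r scale0r addr0 subr0 mulr1.
suff: dk c <= 0 by rewrite -/b -/q; lra.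
rewrite /dk subr_le0 [b + _]addrC -lerBlDr /b -dotvBl.
apply: le_trans (dotv_le_norm2 _ _) _.
(* The gradients differ by at most L c |v|; multiplied by |v| this is exactly the [q * (2 * c)]
   subtracted in [dk c]. *)
have := f_smooth.2 (y + c *: v) y.
rewrite [y + _]addrC addrK norm2Z gtr0_norm // => /ler_wpM2r.
move=> /(_ _ (norm2_ge0 v)) /le_trans; apply.
by rewrite le_eqVlt; apply/orP; left; apply/eqP; rewrite /q; field.
Qed.

End Smooth.

(** * Conjugates and the duality gap *)

Lemma conjugate_ge {R : realType} {n : nat} (phi : 'cV[R]_n -> R)
    (v u : 'cV[R]_n) :
  ((dotv v u - phi u)%:E <= conjugate phi v)%E.
Proof. by apply: ereal_sup_ubound; exists u. Qed.

(** By the descent lemma, <w,u> - f(u) is at least a concave quadratic in u; the supremum is tested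
    at the maximizer of that quadratic, y + (w - grad f(y)) / L. *)
Lemma conjugate_smooth_ge {R : realType} {d : nat} (L : R) (f : 'cV[R]_d -> R)
    (w y : 'cV[R]_d) :
  0 < L -> L_smooth L f ->
  ((dotv w y - f y + norm2 (w - gradient f y) ^+ 2 / (2 * L))%:E
     <= conjugate f w)%E.
Proof.
move=> L_gt0 f_smooth.
apply: (@le_trans _ _
  (dotv w (y + L^-1 *: (w - gradient f y))
   - f (y + L^-1 *: (w - gradient f y)))%:E); last exact: conjugate_ge.
have := descent_lemma L f f_smooth y (L^-1 *: (w - gradient f y)).
move: (gradient f y) => v; move: (f (y + _)) => fu.
rewrite lee_fin dotvDr !dotvZr norm2Z gtr0_norm ?invr_gt0 //.
have : norm2 (w - v) ^+ 2 / (2 * L)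
    = L^-1 * dotv w (w - v) - L^-1 * dotv v (w - v)
      - L / 2 * (L^-1 * norm2 (w - v)) ^+ 2.
  by rewrite -mulrBr -dotvBl -norm2_sqr; field; exact: lt0r_neq0.
by lra.
Qed.

Lemma gradient_dist_le_gap {R : realType} {d n : nat} (L : R)
    (f : 'cV[R]_d -> R) (h : 'cV[R]_n -> R) (A : 'M[R]_(d, n))
    (x xs : 'cV[R]_n) :
  0 < L -> L_smooth L f ->
  (forall z, f (A *m xs) + h xs <= f (A *m z) + h z) ->
  ((norm2 (gradient f (A *m x) - gradient f (A *m xs)) ^+ 2 / (2 * L))%:E
     <= duality_gap f h A x)%E.
Proof.
move=> L_gt0 f_smooth xs_opt; rewrite /duality_gap.
move: (gradient f (A *m x)) => w.
(* The terms <w, A xs> and <-A^T w, xs> from the two conjugates cancel; what remains besides the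
   squared distance is the suboptimality of [x], which is nonnegative. *)
apply: le_trans (leeD (leeD (lexx _)
  (conjugate_smooth_ge L f w (A *m xs) L_gt0 f_smooth))
  (conjugate_ge h (- (A^T *m w)) xs)).
rewrite -!EFinD lee_fin dotvNl dotv_tr_mul.
by have := xs_opt x; lra.
Qed.

Lemma gradient_dist_le_sqrt_gap {R : realType} {d n : nat} (L : R)
    (f : 'cV[R]_d -> R) (h : 'cV[R]_n -> R) (A : 'M[R]_(d, n))
    (x xs : 'cV[R]_n) :
  L_smooth L f ->
  (forall z, f (A *m xs) + h xs <= f (A *m z) + h z) ->
  (duality_gap f h A x < +oo)%E ->
  norm2 (gradient f (A *m x) - gradient f (A *m xs))
    <= Num.sqrt (2 * L * fine (duality_gap f h A x)).
Proof.
move=> f_smooth xs_opt gap_lty.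
(* For L <= 0 the Lipschitz bound already makes the distance nonpositive. *)
have [L_gt0|L_le0] := ltP 0 L; last first.
  apply: le_trans (f_smooth.2 _ _) _; apply: le_trans (sqrtr_ge0 _).
  by rewrite mulr_le0_ge0 ?norm2_ge0.
have gap_ge := gradient_dist_le_gap L f h A x xs L_gt0 f_smooth xs_opt.
(* The real lower bound excludes -oo, so [fine] returns the gap itself and not its default value
   0. *)
have gap_fin : duality_gap f h A x \is a fin_num.
  by rewrite fin_numElt gap_lty andbT (lt_le_trans _ gap_ge) ?ltNyr.
rewrite -[leLHS]ger0_norm ?norm2_ge0 // -sqrtr_sqr ler_sqrt; last first.
  rewrite !mulr_ge0 ?(ltW L_gt0) // -lee_fin fineK //.
  apply: le_trans gap_ge; rewrite lee_fin divr_ge0 ?sqr_ge0 //.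
  by rewrite mulr_ge0 ?(ltW L_gt0).
move: gap_ge; rewrite -{1}(fineK gap_fin) lee_fin ler_pdivrMr ?mulr_gt0 //.
by rewrite mulrC.
Qed.

(** * Optimality condition on a nonzero group *)

Section GroupPenalty.
Context {R : realType} {m d : nat} {p : 'I_m -> nat}.
Variables (A : 'M[R]_(d, \sum_(g < m) p g)) (rho : 'I_m -> R) (L : R).
Variables (f : 'cV[R]_d -> R) (xs : 'cV[R]_(\sum_(g < m) p g)).
Hypothesis f_smooth : L_smooth L f.
Hypothesis xs_opt : forall z, f (A *m xs) + group_penalty rho xs
  <= f (A *m z) + group_penalty rho z.

(** The direction along which group [g] is shrunk. Scaling each block by an indicator keeps it in
    its own dimension [p i], without a cast from [p g]. *)
Definition restrict_group (g : 'I_m) : 'cV[R]_(\sum_(g < m) p g) :=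
  \mxcol_i ((i == g)%:R *: submxcol xs i).

Lemma mul_restrict_group g :
  A *m restrict_group g = submxrow A g *m submxcol xs g.
Proof.
rewrite -[A in LHS]submxrowK mul_mxrow_mxcol (bigD1 g) //= eqxx scale1r.
by rewrite big1 ?addr0 // => i /negPf ->; rewrite scale0r mulmx0.
Qed.

(** Block [g] is scaled by 1 - t, whose nonnegativity makes the penalty exactly affine in t; the
    other blocks are unchanged. *)
Lemma group_penalty_shrink g t : t <= 1 ->
  group_penalty rho (xs - t *: restrict_group g)
    = group_penalty rho xs - t * (Num.sqrt (rho g) * norm2 (submxcol xs g)).
Proof.
move=> t_le1; rewrite /group_penalty (bigD1 g) //= [in RHS](bigD1 g) //=.
have subE i : submxcol (xs - t *: restrict_group g) i
    = (1 - t * (i == g)%:R) *: submxcol xs i.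
  rewrite scalerBl scale1r -scalerA -[in RHS](mxcolK (fun i => _ *: _) i).
  by apply/colP => j; rewrite !mxE.
rewrite subE eqxx mulr1 norm2Z ger0_norm ?subr_ge0 //.
under eq_bigr => i /negPf i_neq_g.
  rewrite subE i_neq_g mulr0 subr0 scale1r; over.
by rewrite /=; ring.
Qed.

Lemma group_stationarity g : submxcol xs g != 0 ->
  Num.sqrt (rho g) <= norm2 ((submxrow A g)^T *m gradient f (A *m xs)).
Proof.
move=> xsg_neq0; set s := submxcol xs g; set ws := gradient f (A *m xs).
have s_gt0 : 0 < norm2 s.
  by rewrite lt_def norm2_ge0 andbT; apply: contra_neq xsg_neq0; apply: norm2_eq0.
rewrite -(ler_pM2r s_gt0).
(* An arbitrary slack [e] replaces the limit of vanishing step size. *)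
apply/ler_addgt0Pr => e e_gt0.
pose C := L / 2 * norm2 (submxrow A g *m s) ^+ 2.
have eC_gt0 : 0 < e + `|C| by rewrite ltr_wpDr.
(* This step lies in (0, 1] and satisfies [t * C <= e]; the absolute value covers a negative [C],
   since [L] carries no sign. *)
pose t := e / (e + `|C|).
have t_gt0 : 0 < t by rewrite divr_gt0.
have t_le1 : t <= 1 by rewrite ler_pdivrMr // mul1r lerDl.
have tC_le : t * C <= e.
  apply: le_trans (ler_wpM2l (ltW t_gt0) (ler_norm C)) _.
  rewrite mulrAC ler_pdivrMr // ler_wpM2l ?(ltW e_gt0) //.
  by rewrite lerDr ltW.
have := xs_opt (xs - t *: restrict_group g).
rewrite (group_penalty_shrink _ _ t_le1) mulmxBr -scalemxAr mul_restrict_group.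
have := descent_lemma L f f_smooth (A *m xs) (- (t *: (submxrow A g *m s))).
rewrite dotvNr dotvZr -scaleNr norm2Z normrN gtr0_norm // exprMn.
(* The first-order change of [f] is -t <A_g^T ws, s>, so Cauchy-Schwarz is needed with the minus
   sign. *)
have := dotv_le_norm2 (- ((submxrow A g)^T *m ws)) s.
rewrite dotvNl dotv_tr_mul -[in norm2 (- _)]scaleN1r norm2Z normrN1 mul1r.
rewrite -(ler_pM2l t_gt0) => dot_le descent opt.
rewrite -(ler_pM2l t_gt0) mulrDr.
(* The quadratic term of the descent lemma is [t * (t * C)], hence at most [t * e]. *)
have := ler_wpM2l (ltW t_gt0) tC_le.
move: dot_le descent opt; rewrite /C; lra.
Qed.

End GroupPenalty.

Theorem theorem18 (R : realType) (m d : nat) (p : 'I_m -> nat)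
    (A : 'M[R]_(d, \sum_(g < m) p g)) (rho : 'I_m -> R) (L : R)
    (f : 'cV[R]_d -> R) (xstar : 'cV[R]_(\sum_(g < m) p g))
    (rho_gt0 : forall g : 'I_m, 0 < rho g)
    (f_convex : convex_function [set: convex_lmodType 'cV[R]_d] f)
    (f_smooth : L_smooth L f)
    (xstar_opt : forall z : 'cV[R]_(\sum_(g < m) p g),
       f (A *m xstar) + group_penalty rho xstar
         <= f (A *m z) + group_penalty rho z) :
  forall (x : 'cV[R]_(\sum_(g < m) p g)) (g : 'I_m),
    (duality_gap f (group_penalty rho) A x < +oo)%E ->
    norm2 ((submxrow A g)^T *m gradient f (A *m x))
      + Num.sqrt (2 * L * fine (duality_gap f (group_penalty rho) A x))
        * normFro (submxrow A g) < Num.sqrt (rho g) ->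
    submxcol xstar g = 0.
Proof.
move=> x g gap_lty lt_rho; apply/eqP; apply: contraTT lt_rho => xsg_neq0.
rewrite -leNgt.
apply: le_trans (group_stationarity A rho L f _ f_smooth xstar_opt g xsg_neq0) _.
set w := gradient f (A *m x); set ws := gradient f (A *m xstar).
(* The triangle inequality then separates the computable A_g^T w from an error bounded by the
   Frobenius norm times the gradient distance. *)
have -> : ws = w - (w - ws) by rewrite subKr.
rewrite mulmxBr -mulmxN (le_trans (norm2D _ _)) // lerD2l.
rewrite opprB (le_trans (norm2_tr_mul_le _ _)) // mulrC.
rewrite ler_wpM2r ?sqrtr_ge0 // norm2B.
exact: gradient_dist_le_sqrt_gap.
Qed.
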